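(* Assume that $F$ is $\mu$-strongly convex with $\mu>0$ and that $f(\cdot;\xi)$ is $L$-smooth for every realization of $\xi$ (the functions $f(\cdot;\xi)$ need not be convex). Let $w_*$ be the unique minimizer of $F$ and $\kappa=\frac{L}{\mu}$. Consider the SGD iteration $w_{t+1}=w_t-\eta_t\nabla f(w_t;\xi_t)$, $t\ge 0$, with a stepsize sequence such that $$0<\eta_t\le\frac{1}{2L\kappa}\ \text{ for all }t\ge0,\qquad\sum_{t=0}^\infty\eta_t=\infty,\qquad\sum_{t=0}^\infty\eta_t^2<\infty.$$ Then, with probability one, $\|w_t-w_*\|^2\to0$ as $t\to\infty$.
   Context: $\xi$ is a random variable, $f(\cdot;\xi):\mathbb{R}^d\to\mathbb{R}$ is differentiable for every realization of $\xi$, $F(w)=\mathbb{E}[f(w;\xi)]$, and $\mathbb{E}[\nabla f(w;\xi)]=\nabla F(w)$ for every fixed $w\in\mathbb{R}^d$. The norm is Euclidean. $\mu$-strong convexity of $F$: $F(w)-F(w')\ge\langle\nabla F(w'),w-w'\rangle+\frac{\mu}{2}\|w-w'\|^2$ for all $w,w'\in\mathbb{R}^d$. $L$-smoothness of $f(\cdot;\xi)$ (with $L>0$ independent of the realization): $\|\nabla f(w;\xi)-\nabla f(w';\xi)\|\le L\|w-w'\|$ for all $w,w'$. In the SGD method, $w_0\in\mathbb{R}^d$ is a given initial point, the stepsizes $\eta_t$ are deterministic, and $\xi_0,\xi_1,\dots$ are i.i.d. copies of $\xi$. The quantity $N=2\mathbb{E}[\|\nabla f(w_*;\xi)\|^2]$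 is assumed finite. *)

(* Defs.v *)
From HB Require Import structures.
From mathcomp Require Import all_boot all_order all_algebra.
From mathcomp Require Import all_classical all_reals all_analysis.

Set Implicit Arguments.
Unset Strict Implicit.
Unset Printing Implicit Defensive.

Import Order.TTheory GRing.Theory Num.Theory.
Import numFieldNormedType.Exports.

Local Open Scope classical_set_scope.
Local Open Scope ring_scope.

Definition dotv (R : realType) (n : nat) (u v : 'rV[R]_n) : R :=
  \sum_i u 0 i * v 0 i.

(* The norm [`|u|] that the library puts on matrices is the max norm; it induces
   the same topology and the same notion of differentiability. *)
Definition enorm (R : realType) (n : nat) (u : 'rV[R]_n) : R :=
  Num.sqrt (dotv u u).

(* Partial derivatives along the canonical basis; meaningful where [g] is
   differentiable (['D_v g w] is an unspecified limit otherwise). *)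
Definition grad (R : realType) (n : nat) (g : 'rV[R]_n -> R) (w : 'rV[R]_n) :
    'rV[R]_n :=
  \row_i 'D_(delta_mx 0 i) g w.

Definition strongly_convex (R : realType) (n : nat) (mu : R)
    (F : 'rV[R]_n -> R) : Prop :=
  forall w w' : 'rV[R]_n,
    F w - F w' >= dotv (grad F w') (w - w') + mu / 2 * enorm (w - w') ^+ 2.

Definition smooth (R : realType) (n : nat) (L : R) (g : 'rV[R]_n -> R) : Prop :=
  forall w w' : 'rV[R]_n, enorm (grad g w - grad g w') <= L * enorm (w - w').

Definition minimizer (R : realType) (n : nat) (F : 'rV[R]_n -> R)
    (w : 'rV[R]_n) : Prop :=
  forall w' : 'rV[R]_n, F w <= F w'.

(* [fine] discards no information when [f w \o xi] is integrable. *)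
Definition objective d d' (T : measurableType d) (S : measurableType d')
    (R : realType) (P : probability T R) (n : nat) (f : 'rV[R]_n -> S -> R)
    (xi : T -> S) (w : 'rV[R]_n) : R :=
  fine 'E_P[fun o => f w (xi o)]%E.

(* The expectation of a random vector is taken coordinate by coordinate. *)
Definition unbiased_grad d d' (T : measurableType d) (S : measurableType d')
    (R : realType) (P : probability T R) (n : nat) (f : 'rV[R]_n -> S -> R)
    (xi : T -> S) (F : 'rV[R]_n -> R) : Prop :=
  forall (w : 'rV[R]_n) (i : 'I_n),
    P.-integrable [set: T] (fun o => (grad (f^~ (xi o)) w 0 i)%:E) /\
    'E_P[fun o => (grad (f^~ (xi o)) w 0 i)%R]%E = (grad F w 0 i)%:E.

Definition grad_noise d d' (T : measurableType d) (S : measurableType d')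
    (R : realType) (P : probability T R) (n : nat) (f : 'rV[R]_n -> S -> R)
    (xi : T -> S) (w : 'rV[R]_n) : \bar R :=
  (2%:E * 'E_P[fun o => (enorm (grad (f^~ (xi o)) w) ^+ 2)%R])%E.

Definition mutually_independent d d' (T : measurableType d)
    (S : measurableType d') (R : realType) (P : probability T R)
    (X : nat -> T -> S) : Prop :=
  forall (s : seq nat) (A : nat -> set S), uniq s ->
    (forall t, measurable (A t)) ->
    (P (\bigcap_(t in [set` s]) (X t @^-1` A t)) =
     \prod_(t <- s) P (X t @^-1` A t))%E.

Definition iid_copies d d' (T : measurableType d) (S : measurableType d')
    (R : realType) (P : probability T R) (xi : {RV P >-> S})
    (xis : nat -> {RV P >-> S}) : Prop :=
  (forall (t : nat) (A : set S), measurable A ->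
     distribution P (xis t) A = distribution P xi A) /\
  mutually_independent P (fun t => xis t : T -> S).

Fixpoint sgd (T S : Type) (R : realType) (n : nat) (f : 'rV[R]_n -> S -> R)
    (xis : nat -> T -> S) (eta : nat -> R) (w0 : 'rV[R]_n) (t : nat) (o : T) :
    'rV[R]_n :=
  if t is t'.+1 then
    let w := sgd f xis eta w0 t' o in
    w - eta t' *: grad (f^~ (xis t' o)) w
  else w0.

(* Main.v *)
Require Import Defs.
From HB Require Import structures.
From mathcomp Require Import all_boot all_order all_algebra.
From mathcomp Require Import all_classical all_reals all_analysis.
From mathcomp Require Import measurable_realfun.
From mathcomp Require Import ring lra.

Set Implicit Arguments.
Unset Strict Implicit.
Unset Printing Implicit Defensive.

Import Order.TTheory GRing.Theory Num.Theory.
Import numFieldNormedType.Exports.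

Local Open Scope classical_set_scope.
Local Open Scope ring_scope.

(** Put [Y t = |w_t - ws|^2].  Strong convexity, Lipschitz gradients and the
    stepsize bound give
      [E(Y (t+1) | F_t) + eta_t mu Y t <= Y t + eta_t^2 N],
    so [V t = Y t + N * \sum_(s >= t) eta_s^2] is a nonnegative supermartingale.
    Since [\sum_t eta_t] diverges, [E (V m)] gets arbitrarily small, and Ville's
    maximal inequality [a P(sup_(t >= m) V t >= a) <= E (V m)] turns this into
    almost sure convergence of [V], hence of [Y], to [0].  Conditional expectations
    are avoided: everything is integrated over events of the sigma-algebra
    generated by the past samples, which is independent of the current sample, so
    that Tonelli's theorem freezes the iterate. *)

(** * Euclidean inner product and norm on row vectors *)

Lemma dotv_ge0 (R : realType) (n : nat) (u : 'rV[R]_n) : 0 <= dotv u u.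
Proof. by apply: sumr_ge0 => i _; rewrite -expr2 sqr_ge0. Qed.

Lemma enorm_sqr (R : realType) (n : nat) (u : 'rV[R]_n) :
  enorm u ^+ 2 = dotv u u.
Proof. by rewrite sqr_sqrtr // dotv_ge0. Qed.

Lemma enorm_ge0 (R : realType) (n : nat) (u : 'rV[R]_n) : 0 <= enorm u.
Proof. exact: sqrtr_ge0. Qed.

Lemma normr_coord_le_enorm (R : realType) (n : nat) (u : 'rV[R]_n) (i : 'I_n) :
  `|u 0 i| <= enorm u.
Proof.
rewrite -sqrtr_sqr ler_wsqrtr // /dotv (bigD1 i) //= -expr2 lerDl.
by apply: sumr_ge0 => j _; rewrite -expr2 sqr_ge0.
Qed.

Lemma enorm_le_coord (R : realType) (n : nat) (u : 'rV[R]_n) (c : R) :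
  0 <= c -> (forall i, `|u 0 i| <= c) -> enorm u <= Num.sqrt n%:R * c.
Proof.
move=> c0 uc; rewrite -[leRHS]ger0_norm ?mulr_ge0 ?sqrtr_ge0 // -sqrtr_sqr.
rewrite ler_wsqrtr // exprMn sqr_sqrtr // mulr_natl.
rewrite -[n in _ *+ n]card_ord -sumr_const; apply: ler_sum => i _.
by rewrite -expr2 -[leLHS]ger0_norm ?sqr_ge0 // normrX lerXn2r // nnegrE.
Qed.

Lemma enormB_sym (R : realType) (n : nat) (u v : 'rV[R]_n) :
  enorm (u - v) = enorm (v - u).
Proof.
by congr Num.sqrt; apply: eq_bigr => i _; rewrite !mxE; ring.
Qed.

Lemma dotvZr (R : realType) (n : nat) (a : R) (u v : 'rV[R]_n) :
  dotv u (a *: v) = a * dotv u v.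
Proof. by rewrite /dotv mulr_sumr; apply: eq_bigr => i _; rewrite mxE; ring. Qed.

Lemma dotvC (R : realType) (n : nat) (u v : 'rV[R]_n) : dotv u v = dotv v u.
Proof. by apply: eq_bigr => i _; rewrite mulrC. Qed.

Lemma dotvZl (R : realType) (n : nat) (a : R) (u v : 'rV[R]_n) :
  dotv (a *: u) v = a * dotv u v.
Proof. by rewrite dotvC dotvZr dotvC. Qed.

Lemma dotv_subD (R : realType) (n : nat) (u v : 'rV[R]_n) :
  dotv (u - v) (u - v) = dotv u u - 2 * dotv u v + dotv v v.
Proof.
rewrite /dotv mulr_sumr -sumrB -big_split; apply: eq_bigr => i _ /=.
by rewrite !mxE; ring.
Qed.

Lemma dotvD_le (R : realType) (n : nat) (u v : 'rV[R]_n) :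
  dotv (u + v) (u + v) <= 2 * dotv u u + 2 * dotv v v.
Proof.
rewrite /dotv !mulr_sumr -big_split; apply: ler_sum => i _ /=.
rewrite !mxE -subr_ge0; set a := u 0 i; set b := v 0 i.
by rewrite (_ : _ - _ = (a - b) ^+ 2) ?sqr_ge0 //; ring.
Qed.

(** * Measurability of gradients and of Lipschitz compositions *)

Definition grid_point (R : realType) (n k : nat) (z : 'rV[int]_n) : 'rV[R]_n :=
  \row_i ((z 0 i)%:~R / k.+1%:R).

(** The values are integer vectors, a countable type, so that a rounded iterate can be split into
    countably many cases. *)
Definition grid_floor (R : realType) (n k : nat) (v : 'rV[R]_n) : 'rV[int]_n :=
  \row_i Num.floor (k.+1%:R * v 0 i).

Lemma enorm_grid (R : realType) (n k : nat) (v : 'rV[R]_n) :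
  enorm (grid_point R k (grid_floor k v) - v) <= Num.sqrt n%:R / k.+1%:R.
Proof.
apply: enorm_le_coord => [|i]; first by rewrite invr_ge0.
rewrite !mxE; have /andP[] := floor_itv (k.+1%:R * v 0 i).
set z := Num.floor _; rewrite intrD => z1 z2.
have k0 : 0 < k.+1%:R :> R by [].
rewrite (_ : _ / _ - _ = (z%:~R - k.+1%:R * v 0 i) / k.+1%:R); last first.
  by move: k0; move: (_.+1%:R) => a /lt0r_neq0 a0; field.
rewrite normrM normfV (ger0_norm (ltW k0)) -[leRHS]mul1r ler_wpM2r ?invr_ge0 //.
by rewrite ler_norml; apply/andP; split; lra.
Qed.

(* Rounding the first argument to the grid leaves countably many cases, each of
   which only involves the measurable maps [h v]; the Lipschitz bound passes to
   the limit. *)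
Lemma measurable_lipschitz_comp (d d' : measure_display) (T : measurableType d)
    (S : measurableType d') (R : realType) (n : nat) (h : 'rV[R]_n -> S -> R)
    (K : R) (W : T -> 'rV[R]_n) (X : T -> S) :
  (forall v, measurable_fun [set: S] (h v)) ->
  (forall s v v', `|h v s - h v' s| <= K * enorm (v - v')) ->
  (forall i, measurable_fun [set: T] (fun o => W o 0 i)) ->
  measurable_fun [set: T] X ->
  measurable_fun [set: T] (fun o => h (W o) (X o)).
Proof.
move=> mh hK mW mX.
apply: (@measurable_fun_cvg _ _ _ _
  (fun k o => h (grid_point R k (grid_floor k (W o))) (X o))) => [k|o _].
  move=> _ B mB; rewrite setTI.
  rewrite (_ : _ @^-1` B = \bigcup_(z : 'rV[int]_n)
    ((\bigcap_(i in [set: 'I_n])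
       [set o | Num.floor (k.+1%:R * W o 0 i) = z 0 i]) `&`
     X @^-1` (h (grid_point R k z) @^-1` B))); last first.
    apply/seteqP; split => [x /= Bo|x [z _ [Wz Bz]] /=].
      exists (grid_floor k (W x)) => //; split => //= i _ /=.
      by rewrite mxE.
    suff -> : grid_floor k (W x) = z by [].
    by apply/rowP => i; rewrite mxE Wz.
  apply: countable_bigcupT_measurable => [|z].
    by apply: countableP.
  apply: measurableI; last first.
    rewrite -[X @^-1` _]setTI; apply: mX => //.
    by rewrite -[h _ @^-1` _]setTI; apply: mh.
  apply: fin_bigcap_measurable => // i _.
  rewrite (_ : [set o | _] = (fun o => k.+1%:R * W o 0 i) @^-1`
      `[(z 0 i)%:~R, (z 0 i + 1)%:~R[%classic).
    rewrite -[_ @^-1` _]setTI.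
    have mkW : measurable_fun [set: T] (fun o => k.+1%:R * W o 0 i).
      by apply: measurable_funM.
    by apply: mkW => //; apply: measurable_itv.
  apply/seteqP; split => o /=; rewrite in_itv /=.
    by move/eqP; rewrite floor_eq.
  by move=> H; apply/eqP; rewrite floor_eq.
(* The rounding error of [enorm_grid] times the Lipschitz constant; [K] may have any sign, hence the
   absolute value. *)
have : `|K| * Num.sqrt n%:R * k.+1%:R^-1 @[k --> \oo] --> (0 : R).
  rewrite -[X in _ --> X](mulr0 (`|K| * Num.sqrt n%:R)).
  by apply: cvgMr; exact: cvg_harmonic.
move/cvgrPdist_lt => cvgK; apply/cvgrPdist_lt => /= e e0.
have := cvgK e e0; apply: filterS => k; rewrite sub0r normrN; apply: le_lt_trans.
apply: le_trans (hK _ _ _) _; apply: le_trans (ler_norm _) _.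
rewrite normrM -mulrA [leRHS]normrM normr_id ler_wpM2l //.
rewrite enormB_sym ger0_norm ?enorm_ge0 //; apply: le_trans (ler_norm _).
exact: enorm_grid.
Qed.

(** A partial derivative is the pointwise limit of the difference quotients with steps [k.+1%:R^-1],
    and each quotient is measurable in [s]. *)
Lemma measurable_grad (d' : measure_display) (S : measurableType d')
    (R : realType) (n : nat) (f : 'rV[R]_n -> S -> R) (v : 'rV[R]_n) (i : 'I_n) :
  (forall v, measurable_fun [set: S] (f v)) ->
  (forall s, differentiable (f^~ s) v) ->
  measurable_fun [set: S] (fun s => grad (f^~ s) v 0 i).
Proof.
move=> mf df.
set e := delta_mx 0 i : 'rV[R]_n.
apply: (@measurable_fun_cvg _ _ _ _
  (fun k s => k.+1%:R * (f (k.+1%:R^-1 *: e + v) s - f v s))) => [k|s _].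
  apply: measurable_funM => //; apply: measurable_funB; exact: mf.
rewrite mxE.
have der : (fun h => h^-1 *: (f (h *: e + v) s - f v s)) h @[h --> 0^'] -->
    'D_e (f^~ s) v := @diff_derivable _ _ _ _ _ e (df s).
(* The punctured limit is restricted to positive increments and then read along the sequence
   [k.+1%:R^-1]. *)
move/cvg_dnbhs_at_right/cvg_at_rightP: der => /(_ (fun k => k.+1%:R^-1)) H.
have {}H := H (conj (fun k => _) cvg_harmonic).
apply: cvg_trans (H _); last by [].
apply: near_eq_cvg; apply: nearW => k /=.
by rewrite invrK.
Qed.

Lemma smooth_coord (R : realType) (n : nat) (L : R) (g : 'rV[R]_n -> R)
    (v w : 'rV[R]_n) (i : 'I_n) :
  smooth L g -> `|grad g v 0 i - grad g w 0 i| <= L * enorm (v - w).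
Proof.
move=> sg; apply: le_trans (sg v w).
by have := normr_coord_le_enorm (grad g v - grad g w) i; rewrite !mxE.
Qed.

(** * Independence and freezing of the past *)

Lemma measurable_id_sigma (d : measure_display) (T : measurableType d)
    (G : set (set T)) :
  <<s G >> `<=` measurable ->
  measurable_fun [set: T] (idfun : T -> g_sigma_algebraType G).
Proof. by move=> sG _ A mA; rewrite setTI; apply: sG. Qed.

(** The identity of [T], read as a map into [T] with the sigma-algebra of [G], carries all the
    information of the past. Its independence from [X] makes the joint law of the pair a product
    measure, and Tonelli's theorem then integrates out [X] with the past held fixed. *)
Lemma integral_freeze (d d' : measure_display) (T : measurableType d)
    (S : measurableType d') (R : realType) (P : probability T R)
    (G : set (set T)) (X : {RV P >-> S})
    (h : g_sigma_algebraType G * S -> \bar R) (A : set T) :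
  <<s G >> `<=` measurable ->
  (forall A B, <<s G >> A -> measurable B ->
    P (A `&` X @^-1` B) = (P A * P (X @^-1` B))%E) ->
  measurable_fun [set: g_sigma_algebraType G * S] h ->
  (forall z, (0 <= h z)%E) ->
  <<s G >> A ->
  (\int[P]_(o in A) h (o, X o) =
   \int[P]_(o in A) \int[P]_o' h (o, X o'))%E.
Proof.
move=> sG ind mh h0 sA.
pose TG : measurableType _ := g_sigma_algebraType G.
have mid := measurable_id_sigma sG.
have mX : measurable_fun [set: T] X by exact: measurable_funP.
pose idM := isMeasurableFun.Build _ _ _ _ _ mid.
pose idG : {mfun T >-> TG} := HB.pack (idfun : T -> TG) idM.
pose PG := distribution P idG.
pose PX := distribution P X.
pose j o : TG * S := (o, X o).
have mj : measurable_fun [set: T] j by exact: measurable_fun_pair.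
pose jM := isMeasurableFun.Build _ _ _ _ _ mj.
pose jj : {mfun T >-> (TG * S)%type} := HB.pack j jM.
(* Independence gives equality on rectangles, which determines the product measure. *)
have prodE B : measurable B -> (PG \x PX)%E B = distribution P jj B.
  apply: product_measure_unique => A1 A2 mA1 mA2.
  rewrite /PG /PX /distribution /pushforward /=.
  by rewrite -ind.
(* The restriction to [A] becomes a factor in the first variable; this is where [A] has to be a past
   event. *)
pose hA z := (h z * (\1_A z.1)%:E)%E.
have mA : measurable A by exact: sG.
have mA1 : measurable_fun [set: TG] (\1_A : TG -> R).
  exact: measurable_indic.
have mA2 : measurable_fun [set: TG * S] (fun z => (\1_A z.1 : R)%:E).
  by apply/measurable_EFinP; exact: (measurableT_comp mA1).
have mhA : measurable_fun [set: TG * S] hA by exact: emeasurable_funM.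
have hA0 z : (0 <= hA z)%E by rewrite mule_ge0 // lee_fin.
transitivity (\int[P]_o (hA \o j) o)%E.
  by rewrite integral_mkcond epatch_indic.
rewrite -(@ge0_integral_distribution _ _ _ _ _ P jj) //.
rewrite (@eq_measure_integral _ _ _ _ (PG \x PX)%E); last first.
  by move=> B mB _; apply/esym; exact: prodE.
rewrite fubini_tonelli1 // ge0_integral_distribution //; last 2 first.
- exact: measurable_fun_fubini_tonelli_F.
- by move=> y; exact: integral_ge0.
rewrite [RHS]integral_mkcond epatch_indic; apply: eq_integral => o _.
have mho : measurable_fun [set: S] (fun y => h (o, y)).
  exact: (@measurable_fun_pair2 _ _ _ TG _ _ h).
have mhAo : measurable_fun [set: S] (fun y => hA (o, y)).
  exact: (@measurable_fun_pair2 _ _ _ TG _ _ hA).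
transitivity (\int[P]_o' hA (o, X o'))%E.
  exact: (ge0_integral_distribution X mhAo (fun y => hA0 (o, y))).
rewrite /hA /= ge0_integralZr //; first exact: (measurableT_comp mho).
Qed.

(** The inner integral is a partial integral against the law of [X], measurable for the
    sigma-algebra of [G] by Tonelli and therefore for the larger one on [T]. *)
Lemma measurable_freeze (d d' : measure_display) (T : measurableType d)
    (S : measurableType d') (R : realType) (P : probability T R)
    (G : set (set T)) (X : {RV P >-> S})
    (h : g_sigma_algebraType G * S -> \bar R) :
  <<s G >> `<=` measurable ->
  measurable_fun [set: g_sigma_algebraType G * S] h ->
  (forall z, (0 <= h z)%E) ->
  measurable_fun [set: T] (fun o => \int[P]_o' h (o, X o'))%E.
Proof.
move=> sG mh h0.
pose TG : measurableType _ := g_sigma_algebraType G.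
have mF : measurable_fun [set: TG] (fubini_F (distribution P X) h).
  exact: measurable_fun_fubini_tonelli_F.
rewrite (_ : (fun o => _) = fubini_F (distribution P X) h \o (idfun : T -> TG)).
  exact: (measurableT_comp mF (measurable_id_sigma sG)).
apply/funext => o; apply/esym.
have mho : measurable_fun [set: S] (fun y => h (o, y)).
  exact: (@measurable_fun_pair2 _ _ _ TG _ _ h).
exact: (ge0_integral_distribution X mho (fun y => h0 (o, y))).
Qed.

(** * Ville's inequality and almost sure convergence of supermartingales *)

Section supermartingale.
Context (d : measure_display) (T : measurableType d) (R : realType)
  (P : probability T R) (Fs : nat -> set (set T)) (V : nat -> T -> R).
Hypothesis FsT : forall t, Fs t [set: T].
Hypothesis FsI : forall t, setI_closed (Fs t).
Hypothesis Fsm : forall t, Fs t `<=` measurable.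
Hypothesis FsS : forall t, Fs t `<=` Fs t.+1.
Hypothesis V0 : forall t o, 0 <= V t o.
Hypothesis mV : forall t, measurable_fun [set: T] (V t).
Hypothesis FsV : forall t a, Fs t [set o | V t o < a].
Hypothesis Vsuper : forall t A, Fs t A ->
  (\int[P]_(o in A) (V t.+1 o)%:E <= \int[P]_(o in A) (V t o)%:E)%E.

(** The event that the first passage of [V] to level [a], from time [m] on, has not happened before
    time [m + k]. The strict [j < k] makes it known one step early, which gives [Fs_below]. *)
Definition below (a : R) (m k : nat) : set T :=
  [set o | forall j, (j < k)%N -> V (m + j) o < a].

Let below0 a m : below a m 0 = [set: T].
Proof. by apply/seteqP; split. Qed.

Let belowS a m k :
  below a m k.+1 = below a m k `&` [set o | V (m + k) o < a].
Proof.
apply/seteqP; split => [x H|x [H1 H2] j] /=.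
  by split => [j jk|]; apply: H => //; apply: ltnW.
by rewrite ltnS leq_eqVlt => /orP[/eqP ->|/H1].
Qed.

Let Fs_below a m k : Fs (m + k) (below a m k).
Proof.
elim: k => [|k IH]; first by rewrite below0.
by rewrite belowS addnS; apply: FsS; apply: FsI.
Qed.

Let measurable_below a m k : measurable (below a m k).
Proof. exact: (@Fsm _ _ (Fs_below _ _ _)). Qed.

(** The left side does not increase with [k]. Split [below a m k] at time [m + k]: where [V] has
    reached [a], its integral pays for the probability added to the first term; on the rest, which
    is an event of [Fs (m + k)], the supermartingale property advances the time by one. *)
Lemma ville_finite (a : R) (m k : nat) : 0 <= a ->
  (a%:E * P (~` below a m k) + \int[P]_(o in below a m k) (V (m + k) o)%:E
    <= \int[P]_o (V m o)%:E)%E.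
Proof.
move=> a0; elim: k => [|k].
  by rewrite below0 setCT measure0 mule0 add0e addn0.
apply: le_trans.
set B := below a m k; set C := [set o | V (m + k) o < a].
have mB : measurable B by exact: measurable_below.
have mC : measurable C by exact: (@Fsm _ _ (FsV _ _)).
have VmE D : measurable_fun D (EFin \o V (m + k)).
  by apply/measurable_EFinP; exact: measurable_funTS.
have mBC : measurable (B `&` C) by exact: measurableI.
have mBnC : measurable (B `&` ~` C).
  by apply: measurableI => //; exact: measurableC.
have -> : (\int[P]_(o in B) (V (m + k) o)%:E =
    \int[P]_(o in B `&` C) (V (m + k) o)%:E +
    \int[P]_(o in B `&` ~` C) (V (m + k) o)%:E)%E.
  rewrite -{1}(setIT B) -(setUv C) setIUr ge0_integral_setU //.
    by move=> x _; rewrite lee_fin.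
  rewrite disj_set2E; apply/eqP; rewrite -subset0 => x [[_ Cx] [_ nCx]].
  exact: nCx.
rewrite belowS -/B -/C setCI.
rewrite (_ : ~` B `|` ~` C = ~` B `|` (B `&` ~` C)); last first.
  by rewrite setUIr [~` B `|` B]setUC setUv setTI.
rewrite measureU //; last 2 first.
- exact: measurableC.
- by rewrite -subset0 => x [nBx [Bx _]]; exact: nBx.
rewrite ge0_muleDr // -addeA leeD2l // addeC leeD //.
  rewrite addnS; apply: Vsuper.
  by rewrite /B /C -belowS; have := FsI (Fs_below a m k) (FsV (m + k) a);
    rewrite -belowS.
rewrite -integral_cst //.
apply: ge0_le_integral => //.
by move=> x [_ /negP]; rewrite /C /= -leNgt lee_fin.
Qed.

Lemma ville (a : R) (m : nat) : 0 < a ->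
  (a%:E * P (\bigcup_k [set o | (a <= V (m + k) o)%R])
    <= \int[P]_o (V m o)%:E)%E.
Proof.
move=> a0.
have -> : \bigcup_k [set o | a <= V (m + k) o] = \bigcup_k ~` below a m k.
  apply/seteqP; split => x [k _] /=.
    move=> aV; exists k.+1 => //= /(_ k (leqnn _)); rewrite ltNge.
    by rewrite aV.
  move=> /existsNP[j] /not_implyP[jk /negP]; rewrite -leNgt => aV.
  by exists j.
have mC k : measurable (~` below a m k) by exact: measurableC.
have H := @nondecreasing_cvg_mu _ _ _ P _ mC (bigcupT_measurable _ mC).
have nd : {homo (fun k => ~` below a m k) : n m / (n <= m)%N >-> (n <= m)%O}.
  move=> i j ij; apply/subsetPset; apply: subsetC => x xB l li; apply: xB.
  exact: leq_trans ij.
have {}H := cvgeZl (y := a%:E) isT (H nd).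
rewrite -(cvg_lim _ H) //; apply: lime_le.
  by apply/cvg_ex; eexists; exact: H.
apply: nearW => k.
apply: le_trans (ville_finite m k (ltW a0)).
by rewrite leeDl // integral_ge0 // => x _; rewrite lee_fin.
Qed.

(** The event that [V] is at least [a] at infinitely many times. *)
Let limsup_ge (a : R) : set T :=
  \bigcap_m \bigcup_k [set o | a <= V (m + k) o].

Let measurable_sup_ge (a : R) m :
  measurable (\bigcup_k [set o | a <= V (m + k) o]).
Proof.
apply: bigcupT_measurable => k.
rewrite (_ : [set o | _] = ~` [set o | V (m + k) o < a]).
  by apply: measurableC; exact: (@Fsm _ _ (FsV _ _)).
by apply/seteqP; split => x /=; rewrite leNgt => /negP.
Qed.

(** For each [m], [limsup_ge a] lies in the event bounded by Ville's inequality from [m] on, so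
    small expectations force it to be null. Failure of convergence to [0] puts a path in
    [limsup_ge i.+1%:R^-1] for some [i], a countable union of null sets. *)
Lemma supermartingale_cvg0 :
  (forall e : R, 0 < e -> exists m, (\int[P]_o (V m o)%:E <= e%:E)%E) ->
  {ae P, forall o, V t o @[t --> \oo] --> (0 : R)}.
Proof.
move=> EV0.
have N0 a : 0 < a -> P.-negligible (limsup_ge a).
  move=> a0; exists (limsup_ge a); split => //.
    exact: bigcapT_measurable.
  apply/eqP; rewrite eq_le measure_ge0 andbT; apply/lee_addgt0Pr => e e0.
  (* The tolerance [a * e] absorbs the factor [a] of Ville's inequality. *)
  rewrite add0e; have [m Em] := EV0 (a * e) (mulr_gt0 a0 e0).
  rewrite -(@lee_pmul2l _ a%:E) // -EFinM.
  apply: le_trans Em; apply: le_trans (ville m a0).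
  rewrite lee_pmul2l //; apply: le_measure; rewrite ?inE //.
    exact: bigcapT_measurable.
  by move=> x /(_ m I).
have : P.-negligible (\bigcup_i limsup_ge i.+1%:R^-1).
  by apply: negligible_bigcup => i; apply: N0; rewrite invr_gt0.
apply: negligibleS => x /= nV; apply: contrapT => nx; apply: nV.
apply/cvgrPdist_lt => e e0.
have [i ie] : exists i : nat, i.+1%:R^-1 < e.
  have /cvgrPdist_lt /(_ e e0) [i _ /(_ i (leqnn _))] := @cvg_harmonic R.
  by rewrite /= sub0r normrN ger0_norm ?invr_ge0 //; exists i.
have : ~ limsup_ge i.+1%:R^-1 x by move=> H; apply: nx; exists i.
move=> /existsNP[m] /not_implyP[_ nm].
exists m => // t /= mt; rewrite sub0r normrN ger0_norm //.
rewrite ltNge; apply/negP => et; apply: nm; exists (t - m)%N => //=.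
by rewrite subnKC // (le_trans (ltW ie)).
Qed.
End supermartingale.

(** * The filtration generated by the past samples *)

Definition history (T : Type) (d' : measure_display) (S : measurableType d')
    (X : nat -> T -> S) (t : nat) : set (set T) :=
  [set A | exists B : nat -> set S, (forall i, measurable (B i)) /\
    A = \bigcap_(i in `I_t) (X i @^-1` B i)].

Section history_theory.
Context (d d' : measure_display) (T : measurableType d) (S : measurableType d')
  (R : realType) (P : probability T R) (X : nat -> {RV P >-> S}).

Local Notation G := (history (fun t => X t : T -> S)).

(** Cylinders thus form a pi-system, as uniqueness of measures requires in [history_independent]. *)
Lemma history_setI t : setI_closed (G t).
Proof.
move=> _ _ [B [mB ->]] [C [mC ->]]; exists (fun i => B i `&` C i); split.
  by move=> i; exact: measurableI.
by rewrite -bigcapI; apply: eq_bigcapr => i _; rewrite preimage_setI.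
Qed.

Lemma historyT t : G t [set: T].
Proof.
exists (fun=> setT); split => //.
by apply/esym; rewrite -subTset => x _ i _.
Qed.

(** The history at time [t] stops at sample [t - 1], so sample [t] first appears at [t.+1]. *)
Lemma history_preimage t (B : set S) : measurable B -> G t.+1 (X t @^-1` B).
Proof.
move=> mB; exists (fun i => if i == t then B else setT); split.
  by move=> i; case: ifP.
apply/seteqP; split => [x Bx i /= _|x /(_ t (ltnSn t))] /=.
  by case: eqP => // ->.
by rewrite eqxx.
Qed.

Lemma sub_historyS t : <<s G t >> `<=` <<s G t.+1 >>.
Proof.
apply: sub_sigma_algebra2 => _ [B [mB ->]].
exists (fun i => if (i < t)%N then B i else setT); split.
  by move=> i; case: ifP.
apply/seteqP; split => [x Bx i /= _|x Bx i /= it].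
  by case: ifP => // it; exact: Bx.
by have := Bx i (ltnW it); rewrite /= it.
Qed.

Lemma history_measurable t : <<s G t >> `<=` measurable.
Proof.
apply: smallest_sub; first exact: sigma_algebra_measurable.
move=> _ [B [mB ->]]; apply: fin_bigcap_measurable => // i _.
by rewrite -[_ @^-1` _]setTI; apply: measurable_funP.
Qed.

(** For fixed [B] both sides are finite measures in [A]: a restriction of [P] and a scalar multiple
    of [P]. They agree on cylinders by mutual independence, hence on the sigma-algebra that
    cylinders generate. *)
Lemma history_independent t (A : set T) (B : set S) :
  mutually_independent P (fun t => X t : T -> S) ->
  <<s G t >> A -> measurable B ->
  P (A `&` X t @^-1` B) = (P A * P (X t @^-1` B))%E.
Proof.
move=> indX sA mB.
have mXB : measurable (X t @^-1` B).
  by rewrite -[_ @^-1` _]setTI; apply: measurable_funP.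
have c0 : 0 <= fine (P (X t @^-1` B)) by rewrite fine_ge0.
pose m1 := mrestr P mXB.
pose m2 := mscale (NngNum c0) P.
have m2E C : m2 C = (P (X t @^-1` B) * P C)%E.
  by rewrite -[X in (X * _)%E]fineK // fin_num_measure.
rewrite muleC -m2E -[LHS]/(m1 A).
apply: (g_sigma_algebra_measure_unique (G t) _ (fun=> setT)) => //.
- by move=> C GC; apply: (@history_measurable t); exact: sub_sigma_algebra.
- by move=> _; exact: historyT.
- by rewrite bigcup_const.
- exact: history_setI.
- move=> _ [C [mC ->]]; rewrite [RHS]m2E [LHS]/(P (_ `&` _)).
  (* Placing [B] in slot [t] turns the intersection into a cylinder over the indices up to [t],
     whose probability factors. *)
  pose C' i := if i == t then B else C i.
  have mC' i : measurable (C' i) by rewrite /C'; case: ifP.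
  have := indX (iota 0 t.+1) C' (iota_uniq _ _) mC'.
  have := indX (iota 0 t) C (iota_uniq _ _) mC.
  have CI n (D : nat -> set S) : \bigcap_(i in [set` iota 0 n]) X i @^-1` D i =
      \bigcap_(i in `I_n) X i @^-1` D i.
    have -> // : [set` iota 0 n] = `I_n.
      by apply/seteqP; split => i /=; rewrite mem_iota add0n.
  rewrite !CI => PC PC'.
  have EC' : \bigcap_(i in `I_t) (X i @^-1` C i) `&` X t @^-1` B =
      \bigcap_(i in `I_t.+1) (X i @^-1` C' i).
    apply/seteqP; split => [x [Cx Bx] i /= it|x C'x].
      rewrite /C'; case: eqP => [->//|/eqP it'].
      by apply: Cx => /=; rewrite ltn_neqAle it' -ltnS.
    split => [i /= it|].
      by have := C'x i (ltnW it); rewrite /C' /= ltn_eqF.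
    by have := C'x t (ltnSn t); rewrite /C' /= eqxx.
  rewrite EC'; apply: (etrans PC').
  apply: etrans (esym (congr1 (fun z => P (X t @^-1` B) * z)%E PC)).
  rewrite -[in LHS]addn1 iotaD big_cat /= big_seq1 add0n muleC.
  rewrite {1}/C' eqxx; congr (_ * _)%E.
  apply: eq_big_seq => i; rewrite mem_iota add0n /C' => /andP[_ it].
  by rewrite ltn_eqF.
- move=> _; rewrite /m1 /mrestr (le_lt_trans (probability_le1 _ _)) ?ltry //.
  by rewrite setTI.
Qed.

End history_theory.

(** By induction on [t]: the new gradient is evaluated at a random point, and smoothness makes that
    composition measurable through [measurable_lipschitz_comp]. *)
Lemma sgd_adapted (d d' : measure_display) (T : measurableType d)
    (S : measurableType d') (R : realType) (P : probability T R) (n : nat)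
    (X : nat -> {RV P >-> S}) (f : 'rV[R]_n -> S -> R) (L : R)
    (eta : nat -> R) (w0 : 'rV[R]_n) (t : nat) (i : 'I_n) :
  (forall v : 'rV[R]_n, measurable_fun [set: S] (f v)) ->
  (forall (s : S) (v : 'rV[R]_n), differentiable (f^~ s) v) ->
  (forall s : S, smooth L (f^~ s)) ->
  measurable_fun [set: g_sigma_algebraType (history (fun t => X t : T -> S) t)]
    (fun o => sgd f (fun t => X t : T -> S) eta w0 t o 0 i).
Proof.
move=> mf df sf; elim: t i => [|t IH] i; first exact: measurable_cst.
set GS := g_sigma_algebraType _.
have mW j : measurable_fun [set: GS]
    (fun o => sgd f (fun t => X t : T -> S) eta w0 t o 0 j).
  move=> _ B mB; apply: sub_historyS.
  exact: (IH j measurableT B mB).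
rewrite (_ : (fun o => _) = fun o : GS =>
  sgd f (fun t => X t : T -> S) eta w0 t o 0 i -
  eta t * grad (f^~ (X t o)) (sgd f (fun t => X t : T -> S) eta w0 t o) 0 i);
  last by apply/funext => o /=; rewrite !mxE.
apply: measurable_funB => //; apply: measurable_funM => //.
apply: (@measurable_lipschitz_comp _ _ GS S R n
  (fun v s => grad (f^~ s) v 0 i) L _ (X t)) => //.
- by move=> v; exact: measurable_grad.
- by move=> s v v'; exact: smooth_coord.
- move=> _ B mB; rewrite setTI; apply: sub_sigma_algebra.
  exact: history_preimage.
Qed.

(** * Strong convexity and the expected one-step descent *)

Lemma strongly_convex_growth (R : realType) (n : nat) (mu : R)
    (F : 'rV[R]_n -> R) (ws v : 'rV[R]_n) :
  strongly_convex mu F -> minimizer F ws -> 0 <= mu ->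
  mu / 2 * enorm (v - ws) ^+ 2 <= F v - F ws.
Proof.
move=> scF minF mu0.
set D := enorm _ ^+ 2; have D0 : 0 <= D by rewrite sqr_ge0.
(* Strong convexity at the intermediate point [u], applied towards [v] and towards [ws] with weights
   [s] and [1 - s], cancels the gradient at [u]; minimality gives [F ws <= F u]. The claim is the
   limit [s -> 0]. *)
have key s : 0 < s -> s < 1 -> mu / 2 * D * (1 - s) <= F v - F ws.
  move=> s0 s1; set u := ws + s *: (v - ws).
  have Eu1 : ws - u = (- s) *: (v - ws).
    by apply/rowP => i; rewrite !mxE; ring.
  have Eu2 : v - u = (1 - s) *: (v - ws).
    by apply/rowP => i; rewrite !mxE; ring.
  have en a : enorm (a *: (v - ws)) ^+ 2 = a ^+ 2 * D.
    by rewrite /D !enorm_sqr dotvZr dotvZl mulrA -expr2.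
  have := scF ws u; rewrite Eu1 dotvZr en.
  have := scF v u; rewrite Eu2 dotvZr en.
  have := minF u.
  set g := dotv _ _; set c := mu / 2 => H1 H2 H3.
  rewrite -(ler_pM2l s0).
  have K1 : 0 <= s * (F v - F u - ((1 - s) * g + c * ((1 - s) ^+ 2 * D))).
    by rewrite mulr_ge0 ?subr_ge0 // ltW.
  have K2 : 0 <= (1 - s) * (F ws - F u - (- s * g + c * ((- s) ^+ 2 * D))).
    by rewrite mulr_ge0 ?subr_ge0 // ltW.
  nra.
have c0 : 0 <= F v - F ws by rewrite subr_ge0.
have c'0 : 0 <= mu / 2 * D by rewrite mulr_ge0 // divr_ge0.
rewrite leNgt; apply/negP => lt.
move: key lt c0 c'0; move: (F v - F ws) (mu / 2 * D) => c c' key lt c0 c'0.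
have c'p : 0 < c' by lra.
(* With this [s], [c' * (1 - s)] is the midpoint of [c] and [c'], which exceeds [c] and contradicts
   [key]. *)
have s0 : 0 < (c' - c) / (2 * c') by rewrite divr_gt0 ?subr_gt0 ?mulr_gt0.
have s1 : (c' - c) / (2 * c') < 1 by rewrite ltr_pdivrMr ?mulr_gt0 //; lra.
have := key _ s0 s1.
have -> : c' * (1 - (c' - c) / (2 * c')) = (c' + c) / 2 by field; lra.
lra.
Qed.

(** Strong convexity at [v] towards [ws] and the growth bound each contribute [mu / 2]. *)
Lemma strongly_convex_dotv_grad (R : realType) (n : nat) (mu : R)
    (F : 'rV[R]_n -> R) (ws v : 'rV[R]_n) :
  strongly_convex mu F -> minimizer F ws -> 0 <= mu ->
  mu * enorm (v - ws) ^+ 2 <= dotv (v - ws) (grad F v).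
Proof.
move=> scF minF mu0.
have := strongly_convex_growth v scF minF mu0.
have := scF ws v; rewrite enormB_sym.
rewrite -(opprB v ws) -scaleN1r dotvZr mulN1r dotvC.
by move=> *; lra.
Qed.

(** Expand the square and compare the gradient at [v] with the one at [ws]: the difference is
    Lipschitz, and the remainder is the noise at the minimizer. *)
Lemma sgd_step_le (R : realType) (n : nat) (L eta : R) (g : 'rV[R]_n -> R)
    (ws v : 'rV[R]_n) : smooth L g -> 0 <= L ->
  enorm (v - eta *: grad g v - ws) ^+ 2 <=
    (1 + 2 * eta ^+ 2 * L ^+ 2) * enorm (v - ws) ^+ 2
    - 2 * eta * dotv (v - ws) (grad g v)
    + 2 * eta ^+ 2 * enorm (grad g ws) ^+ 2.
Proof.
move=> sg L0.
have le_g : enorm (grad g v) ^+ 2 <=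
    2 * (L ^+ 2 * enorm (v - ws) ^+ 2) + 2 * enorm (grad g ws) ^+ 2.
  have := dotvD_le (grad g v - grad g ws) (grad g ws); rewrite subrK -!enorm_sqr.
  move/le_trans; apply; rewrite lerD2r ler_pM2l // -exprMn lerXn2r ?nnegrE //.
  - exact: enorm_ge0.
  - by rewrite mulr_ge0 // enorm_ge0.
rewrite addrAC enorm_sqr dotv_subD !dotvZr dotvZl -!enorm_sqr.
have := ler_wpM2l (sqr_ge0 eta) le_g.
rewrite !expr2; lra.
Qed.

(** Taking expectations in [sgd_step_le] turns the linear term into one with [grad F v], worth at
    least [2 * eta * mu] times the squared distance. Half of it pays for the [L ^+ 2] term by the
    stepsize bound; the other half is the decrease. *)
Lemma expected_sgd_step_le (d d' : measure_display) (T : measurableType d)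
    (S : measurableType d') (R : realType) (P : probability T R) (n : nat)
    (xi : {RV P >-> S}) (f : 'rV[R]_n -> S -> R) (F : 'rV[R]_n -> R)
    (mu L eta : R) (ws v : 'rV[R]_n) :
  (forall v : 'rV[R]_n, measurable_fun [set: S] (f v)) ->
  (forall (s : S) (v : 'rV[R]_n), differentiable (f^~ s) v) ->
  (forall s : S, smooth L (f^~ s)) ->
  unbiased_grad P f xi F ->
  strongly_convex mu F -> minimizer F ws ->
  (grad_noise P f xi ws < +oo)%E ->
  0 < mu -> 0 < L -> 0 < eta <= 1 / (2 * L * (L / mu)) ->
  (\int[P]_o (enorm (v - eta *: grad (f^~ (xi o)) v - ws) ^+ 2)%:E +
     (eta * mu * enorm (v - ws) ^+ 2)%:E <=
   (enorm (v - ws) ^+ 2 + eta ^+ 2 * fine (grad_noise P f xi ws))%:E)%E.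
Proof.
move=> mf df sf ub scF minF noise mu0 L0 /andP[eta0 eta_le].
have mxi : measurable_fun [set: T] xi by exact: measurable_funP.
have mg w i : measurable_fun [set: T] (fun o => grad (f^~ (xi o)) w 0 i).
  apply: (measurableT_comp _ mxi (f := fun s => grad (f^~ s) w 0 i)).
  by apply: measurable_grad => // s; exact: df.
pose q o := enorm (grad (f^~ (xi o)) ws) ^+ 2.
have mq : measurable_fun [set: T] q.
  rewrite (_ : q = fun o => \sum_i
      grad (f^~ (xi o)) ws 0 i * grad (f^~ (xi o)) ws 0 i).
    by apply: measurable_sum => i; exact: measurable_funM.
  by apply/funext => o; rewrite /q enorm_sqr.
have Eq : (\int[P]_o (q o)%:E \is a fin_num)%E.
  rewrite ge0_fin_numE; last by apply: integral_ge0 => o _; rewrite lee_fin sqr_ge0.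
  rewrite ltey; apply/eqP => Eoo; move: noise.
  by rewrite /grad_noise unlock Eoo gt0_muley // ltxx.
have iq : P.-integrable [set: T] (EFin \o q).
  apply/integrableP; split; first exact/measurable_EFinP.
  move: Eq; rewrite fin_numElt => /andP[_]; apply: le_lt_trans.
  apply: ge0_le_integral => //.
  - by apply: measurableT_comp => //; exact/measurable_EFinP.
  - exact/measurable_EFinP.
  - by move=> o _ /=; rewrite ger0_norm // sqr_ge0.
have Enoise : fine (grad_noise P f xi ws) = 2 * fine (\int[P]_o (q o)%:E)%E.
  by rewrite /grad_noise unlock -/q fineM.
pose lin o := dotv (v - ws) (grad (f^~ (xi o)) v).
have linE o : (lin o)%:E =
    (\sum_i ((v - ws) 0 i)%:E * (grad (f^~ (xi o)) v 0 i)%:E)%E.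
  by rewrite /lin /dotv -sumEFin; apply: eq_bigr => i _; rewrite EFinM.
have ilin : P.-integrable [set: T] (EFin \o lin).
  rewrite (_ : EFin \o lin = fun o =>
      (\sum_i ((v - ws) 0 i)%:E * (grad (f^~ (xi o)) v 0 i)%:E)%E); last first.
    by apply/funext => o; rewrite -linE.
  by apply: integrable_sum => // i _; apply: integrableZl => //; case: (ub v i).
have Elin : (\int[P]_o (lin o)%:E = (dotv (v - ws) (grad F v))%:E)%E.
  under eq_integral do rewrite linE.
  rewrite integral_sum //; last first.
    by move=> i; apply: integrableZl => //; case: (ub v i).
  rewrite /dotv -sumEFin; apply: eq_bigr => i _.
  case: (ub v i) => gi; rewrite unlock => Egi.
  by rewrite integralZl // Egi EFinM.
set D := enorm (v - ws) ^+ 2.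
have D0 : 0 <= D by rewrite sqr_ge0.
pose a := (1 + 2 * eta ^+ 2 * L ^+ 2) * D.
pose b := - (2 * eta).
pose c := 2 * eta ^+ 2.
have step o : enorm (v - eta *: grad (f^~ (xi o)) v - ws) ^+ 2 <=
    a + (b * lin o + c * q o).
  apply: le_trans (sgd_step_le eta ws v (sf (xi o)) (ltW L0)) _.
  by rewrite /a /b /c /D /lin /q mulNr addrA.
have iR : P.-integrable [set: T] (fun o => (b%:E * (lin o)%:E + c%:E * (q o)%:E)%E).
  by apply: integrableD => //; exact: integrableZl.
have mphi : measurable_fun [set: T]
    (fun o => (enorm (v - eta *: grad (f^~ (xi o)) v - ws) ^+ 2)%:E).
  apply/measurable_EFinP.
  rewrite (_ : (fun o => _) = fun o => \sum_i
      (v 0 i - eta * grad (f^~ (xi o)) v 0 i - ws 0 i) ^+ 2).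
    apply: measurable_sum => i; apply: measurable_funX.
    by do 2 apply: measurable_funB => //; apply: measurable_funM.
  apply/funext => o; rewrite enorm_sqr; apply: eq_bigr => i _.
  by rewrite !mxE expr2.
have intR : (\int[P]_o (enorm (v - eta *: grad (f^~ (xi o)) v - ws) ^+ 2)%:E <=
    (a + (b * dotv (v - ws) (grad F v) + c * fine (\int[P]_o (q o)%:E)))%:E)%E.
  apply: (@le_trans _ _ (\int[P]_o (a%:E + (b%:E * (lin o)%:E + c%:E * (q o)%:E)))%E).
    apply: ge0_le_integral => //.
    - by move=> o _; rewrite lee_fin sqr_ge0.
    - by apply: emeasurable_funD => //; case/integrableP: iR.
    - by move=> o _; rewrite -!EFinM -!EFinD lee_fin.
  rewrite integralD //; last exact: finite_measure_integrable_cst.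
  rewrite integralD //; try exact: integrableZl.
  have Ea : (\int[P]_o a%:E = a%:E)%E.
    by have := expectation_cst P a; rewrite unlock.
  rewrite !integralZl // Elin Ea.
  by rewrite !EFinD !EFinM fineK.
apply: (le_trans (leeD2r _ intR)); rewrite -EFinD lee_fin Enoise.
have H1 := strongly_convex_dotv_grad v scF minF (ltW mu0).
(* The stepsize bound with [kappa = L / mu] unfolded and denominators cleared. *)
have H2 : 2 * eta * L ^+ 2 <= mu.
  move: eta_le; rewrite ler_pdivlMr; last by rewrite !mulr_gt0 ?invr_gt0.
  rewrite -(ler_pM2r mu0) mul1r; apply: le_trans; rewrite le_eqVlt; apply/orP; left.
  by apply/eqP; field; rewrite gt_eqF.
rewrite /a /b /c -/D in H1 *.
have H3 : eta * (mu * D) <= eta * dotv (v - ws) (grad F v) by rewrite ler_pM2l.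
have H4 : eta * D * (2 * eta * L ^+ 2) <= eta * D * mu.
  by rewrite ler_wpM2l // mulr_ge0 // ltW.
by rewrite !expr2 in H4 *; lra.
Qed.

(** * Series tails and the deterministic recursion *)

Lemma summable_tail (R : realType) (u : nat -> R) :
  (forall t, 0 <= u t) -> (\sum_(0 <= t <oo) (u t)%:E < +oo)%E ->
  exists r : nat -> R, [/\ forall t, 0 <= r t,
    forall t, r t = u t + r t.+1 & r t @[t --> \oo] --> (0 : R)].
Proof.
move=> u0 sumu.
have uE0 k : (0 <= (u k)%:E)%E by rewrite lee_fin.
pose tail t := (\sum_(t <= k <oo) (u k)%:E)%E.
have tail0 t : (0 <= tail t)%E by apply: nneseries_ge0 => k _ _.
have tailS t : tail t = ((u t)%:E + tail t.+1)%E.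
  by rewrite {1}/tail (nneseries_split t 1) // addn1 big_nat1.
have tail_fin t : tail t \is a fin_num.
  rewrite ge0_fin_numE //; apply: le_lt_trans sumu.
  by rewrite (nneseries_split 0 t) // add0n leeDr // sume_ge0.
exists (fine \o tail); split => [t|t|] /=.
- exact: fine_ge0.
- by rewrite tailS fineD //= tail_fin.
- apply: fine_cvg; exact: (nneseries_tail_cvg sumu).
Qed.

(* If the potential [y + N r] stayed above [e], then [y] would eventually stay
   above [e / 2], and the decrements [eta t * mu * y t] would sum to infinity. *)
Lemma potential_le (R : realType) (mu N : R) (eta y r : nat -> R) :
  0 < mu -> 0 <= N -> (forall t, 0 < eta t) ->
  (\sum_(0 <= t <oo) (eta t)%:E = +oo)%E ->
  (forall t, 0 <= y t) -> (forall t, 0 <= r t) ->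
  (forall t, r t = eta t ^+ 2 + r t.+1) -> r t @[t --> \oo] --> (0 : R) ->
  (forall t, y t.+1 + eta t * mu * y t <= y t + eta t ^+ 2 * N) ->
  forall e, 0 < e -> exists m, y m + N * r m <= e.
Proof.
move=> mu0 N0 eta0 sum_eta y0 r0 rS r_cvg ystep e e0; apply: contrapT => nle.
have gt_e m : e < y m + N * r m.
  by rewrite ltNge; apply/negP => le_e; apply: nle; exists m.
have [m0 r_small] : exists m0, forall m, (m0 <= m)%N -> N * r m <= e / 2.
  (* Dividing by [N + 1] rather than [N] covers [N = 0]. *)
  have d0 : 0 < e / 2 / (N + 1) by rewrite !divr_gt0 // ltr_wpDl.
  have /cvgrPdist_lt /(_ _ d0) [m0 _ H] := r_cvg.
  exists m0 => m /H; rewrite /= sub0r normrN ger0_norm // ltr_pdivlMr ?ltr_wpDl //.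
  by have := r0 m; lra.
pose a := mu * (e / 2); have a0 : 0 < a by rewrite mulr_gt0 // divr_gt0.
(* The value at [k = 0] of the left side of [bound], a quantity that never increases with [k]. *)
pose C := a * (\sum_(0 <= t < m0) eta t) + (y m0 + N * r m0).
have bound k : a * (\sum_(0 <= t < m0 + k) eta t) +
    (y (m0 + k)%N + N * r (m0 + k)%N) <= C.
  elim: k => [|k]; first by rewrite addn0.
  apply: le_trans; rewrite addnS big_nat_recr //=; set t := (m0 + k)%N.
  have ey : e / 2 <= y t.
    have := gt_e t; have := r_small t (leq_addr _ _); lra.
  have := ystep t; rewrite (rS t).
  have : eta t * mu * (e / 2) <= eta t * mu * y t by rewrite ler_pM2l // mulr_gt0.
  rewrite /a; set s := \sum_(_ <= _ < _) _; lra.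
have : (\sum_(0 <= t <oo) (eta t)%:E <= (C / a)%:E)%E.
  apply: lime_le.
    by apply: is_cvg_nneseries => k _ _; rewrite lee_fin ltW.
  exists m0 => // k /= mk; rewrite sumEFin lee_fin ler_pdivlMr // mulrC.
  have := bound (k - m0)%N; rewrite subnKC //.
  by have := y0 k; have := mulr_ge0 N0 (r0 k); lra.
by rewrite sum_eta.
Qed.

(** * Descent over past events and almost sure convergence *)

Lemma sgd_conditional_step_le (d d' : measure_display) (T : measurableType d)
    (S : measurableType d') (R : realType) (P : probability T R) (n : nat)
    (xi : {RV P >-> S}) (xis : nat -> {RV P >-> S})
    (f : 'rV[R]_n -> S -> R) (F : 'rV[R]_n -> R) (mu L : R)
    (ws w0 : 'rV[R]_n) (eta : nat -> R) (t : nat) (A : set T) :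
  let w := sgd f (fun t => xis t : T -> S) eta w0 in
  (forall v : 'rV[R]_n, measurable_fun [set: S] (f v)) ->
  (forall (s : S) (v : 'rV[R]_n), differentiable (f^~ s) v) ->
  (forall s : S, smooth L (f^~ s)) ->
  unbiased_grad P f xi F -> iid_copies xi xis ->
  strongly_convex mu F -> minimizer F ws ->
  (grad_noise P f xi ws < +oo)%E ->
  0 < mu -> 0 < L -> 0 < eta t <= 1 / (2 * L * (L / mu)) ->
  <<s history (fun t => xis t : T -> S) t >> A ->
  (\int[P]_(o in A) (enorm (w t.+1 o - ws) ^+ 2)%:E +
     (eta t * mu)%:E * \int[P]_(o in A) (enorm (w t o - ws) ^+ 2)%:E <=
   \int[P]_(o in A) (enorm (w t o - ws) ^+ 2)%:E +
     (eta t ^+ 2 * fine (grad_noise P f xi ws))%:E * P A)%E.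
Proof.
move=> w mf df sf ub [same_law indep] scF minF noise mu0 L0 eta_t sA.
have eta0 : 0 < eta t by case/andP: eta_t.
set N := fine _.
have N0 : 0 <= N.
  apply: fine_ge0; rewrite /grad_noise unlock mule_ge0 //.
  by apply: integral_ge0 => o _; rewrite lee_fin sqr_ge0.
pose G := history (fun t => xis t : T -> S) t.
pose TG : measurableType _ := g_sigma_algebraType G.
have sG : <<s G >> `<=` measurable by exact: history_measurable.
have mA : measurable A by exact: sG.
have mw i : measurable_fun [set: TG] (fun o => w t o 0 i) by exact: sgd_adapted.
pose h (z : TG * S) : \bar R :=
  (enorm (w t z.1 - eta t *: grad (f^~ z.2) (w t z.1) - ws) ^+ 2)%:E.
have mw1 i : measurable_fun [set: TG * S] (fun z => w t z.1 0 i).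
  exact: (measurableT_comp (mw i) measurable_fst).
have mh : measurable_fun [set: TG * S] h.
  apply/measurable_EFinP.
  rewrite (_ : (fun z => _) = fun z : TG * S => \sum_i
      (w t z.1 0 i - eta t * grad (f^~ z.2) (w t z.1) 0 i - ws 0 i) ^+ 2).
    apply: measurable_sum => i; apply: measurable_funX.
    apply: measurable_funB => //; apply: measurable_funB => //.
    apply: measurable_funM => //.
    apply: (@measurable_lipschitz_comp _ _ (TG * S)%type S R n
      (fun v s => grad (f^~ s) v 0 i) L (fun z : TG * S => w t z.1) snd) => //.
    - by move=> v; exact: measurable_grad.
    - by move=> s v v'; exact: smooth_coord.
  apply/funext => z; rewrite enorm_sqr; apply: eq_bigr => i _.
  by rewrite !mxE expr2.
have h0 z : (0 <= h z)%E by rewrite lee_fin sqr_ge0.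
have mY : measurable_fun [set: T] (fun o => (enorm (w t o - ws) ^+ 2)%:E).
  apply/measurable_EFinP.
  rewrite (_ : (fun o => _) = fun o => \sum_i (w t o 0 i - ws 0 i) ^+ 2).
    apply: measurable_sum => i; apply: measurable_funX.
    apply: measurable_funB => // _ B mB; rewrite setTI; apply: sG.
    by have := mw i measurableT B mB; rewrite setTI.
  apply/funext => z; rewrite enorm_sqr; apply: eq_bigr => i _.
  by rewrite !mxE expr2.
(* The expected squared distance after one step when the iterate is frozen at [w t o] and only the
   sample is random; it plays the part of a conditional expectation. *)
pose inner o := (\int[P]_o' h (o, xis t o'))%E.
have minner : measurable_fun [set: T] inner by exact: measurable_freeze.
have inner0 o : (0 <= inner o)%E by exact: integral_ge0.
have inner_le o : (inner o + (eta t * mu)%:E * (enorm (w t o - ws) ^+ 2)%:E <=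
    (enorm (w t o - ws) ^+ 2)%:E + (eta t ^+ 2 * N)%:E)%E.
  have mho : measurable_fun [set: S] (fun s => h (o, s)).
    exact: (@measurable_fun_pair2 _ _ _ TG _ _ h).
  (* Only the law of the sample enters, so [xis t] may be replaced by [xi]. *)
  have -> : inner o = (\int[P]_o' h (o, xi o'))%E.
    have ho0 y : (0 <= h (o, y))%E by [].
    apply: etrans (esym (ge0_integral_distribution (xis t) mho ho0)) _.
    apply: etrans _ (ge0_integral_distribution xi mho ho0).
    by apply: eq_measure_integral => B mB _; exact: same_law.
  rewrite -EFinM -EFinD.
  exact: (expected_sgd_step_le (w t o) mf df sf ub scF minF noise mu0 L0
    eta_t).
have -> : (\int[P]_(o in A) (enorm (w t.+1 o - ws) ^+ 2)%:E =
    \int[P]_(o in A) inner o)%E.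
  apply: (@integral_freeze _ _ T S R P G (xis t) h) => //.
  by move=> A' B sA' mB; exact: history_independent.
have Y0 o : (0 <= (enorm (w t o - ws) ^+ 2)%:E)%E by rewrite lee_fin sqr_ge0.
have em0 : (0 <= (eta t * mu)%:E)%E by rewrite lee_fin mulr_ge0 // ltW.
have eN0 : (0 <= (eta t ^+ 2 * N)%:E)%E by rewrite lee_fin mulr_ge0 // sqr_ge0.
have mYA := measurable_funS measurableT (@subsetT _ A) mY.
have mIA := measurable_funS measurableT (@subsetT _ A) minner.
rewrite -ge0_integralZl // -integral_cst // -!ge0_integralD //.
- apply: ge0_le_integral => //.
  + by move=> o _; rewrite adde_ge0 // mule_ge0.
  + by apply: emeasurable_funD => //; apply: measurable_funeM.
  + by apply: emeasurable_funD.
- by move=> o _; rewrite mule_ge0.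
- exact: measurable_funeM.
Qed.

Theorem theorem3 (d d' : measure_display) (T : measurableType d)
    (S : measurableType d') (R : realType) (P : probability T R) (n : nat)
    (xi : {RV P >-> S}) (xis : nat -> {RV P >-> S})
    (f : 'rV[R]_n -> S -> R) (mu L : R)
    (ws w0 : 'rV[R]_n) (eta : nat -> R) :
  let F := objective P f xi in
  let kappa := L / mu in
  let w := sgd f (fun t => xis t : T -> S) eta w0 in
  (forall v : 'rV[R]_n, measurable_fun [set: S] (f v)) ->
  (forall (s : S) (v : 'rV[R]_n), differentiable (f^~ s) v) ->
  (forall v : 'rV[R]_n, P.-integrable [set: T] (fun o => (f v (xi o))%:E)) ->
  (forall v : 'rV[R]_n, differentiable F v) ->
  unbiased_grad P f xi F ->
  iid_copies xi xis ->
  0 < mu ->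
  0 < L ->
  strongly_convex mu F ->
  (forall s : S, smooth L (f^~ s)) ->
  unique (minimizer F) ws ->
  (grad_noise P f xi ws < +oo)%E ->
  (forall t : nat, 0 < eta t <= 1 / (2 * L * kappa)) ->
  (\sum_(0 <= t <oo) (eta t)%:E = +oo)%E ->
  (\sum_(0 <= t <oo) (eta t ^+ 2)%:E < +oo)%E ->
  {ae P, forall o : T, (fun t : nat => enorm (w t o - ws) ^+ 2) @ \oo --> (0 : R)}.
Proof.
move=> F kappa w mf df _ _ ub iid mu0 L0 scF sf [minF _] noise eta_bound
  sum_eta sum_eta2.
pose Y t o := enorm (w t o - ws) ^+ 2.
pose Fs t := <<s history (fun t => xis t : T -> S) t >>.
set N := fine (grad_noise P f xi ws).
have N0 : 0 <= N.
  apply: fine_ge0; rewrite /grad_noise unlock mule_ge0 //.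
  by apply: integral_ge0 => o _; rewrite lee_fin sqr_ge0.
have eta0 t : 0 < eta t by case/andP: (eta_bound t).
have Y0 t o : 0 <= Y t o by exact: sqr_ge0.
have step t A : Fs t A ->
    (\int[P]_(o in A) (Y t.+1 o)%:E +
       (eta t * mu)%:E * \int[P]_(o in A) (Y t o)%:E <=
     \int[P]_(o in A) (Y t o)%:E + (eta t ^+ 2 * N)%:E * P A)%E.
  by move=> sA; exact: (sgd_conditional_step_le w0 mf df sf ub iid scF minF noise
    mu0 L0 (eta_bound t) sA).
have mYF t : measurable_fun
    [set: g_sigma_algebraType (history (fun t => xis t : T -> S) t)] (Y t).
  rewrite (_ : Y t = fun o => \sum_i (w t o 0 i - ws 0 i) ^+ 2).
    apply: measurable_sum => i; apply: measurable_funX.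
    by apply: measurable_funB => //; exact: sgd_adapted.
  apply/funext => o; rewrite /Y enorm_sqr; apply: eq_bigr => i _.
  by rewrite !mxE expr2.
have FsY t B : measurable B -> Fs t (Y t @^-1` B).
  by move=> mB; have := mYF t measurableT B mB; rewrite setTI.
have Fsm t : Fs t `<=` measurable by exact: history_measurable.
have mY t : measurable_fun [set: T] (Y t).
  by move=> _ B mB; rewrite setTI; apply: Fsm; exact: FsY.
have FsT t : Fs t [set: T] by apply: sub_sigma_algebra; exact: historyT.
have EY0 t : (0 <= \int[P]_o (Y t o)%:E)%E.
  by apply: integral_ge0 => o _; rewrite lee_fin.
(* Finiteness propagates from the constant [w0] through the one-step bound, which allows passing to
   the real sequence [y]. *)
have EY_fin t : (\int[P]_o (Y t o)%:E)%E \is a fin_num.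
  elim: t => [|t IH].
    by have := expectation_cst P (enorm (w0 - ws) ^+ 2); rewrite unlock => ->.
  rewrite ge0_fin_numE //; apply: (@le_lt_trans _ _
    (\int[P]_o (Y t o)%:E + (eta t ^+ 2 * N)%:E * P [set: T])%E).
    apply: le_trans (step t _ (FsT t)); rewrite leeDl // mule_ge0 // lee_fin.
    by rewrite mulr_ge0 // ltW.
  by rewrite probability_setT mule1 -(fineK IH) -EFinD ltry.
pose y t := fine (\int[P]_o (Y t o)%:E)%E.
have y_step t : y t.+1 + eta t * mu * y t <= y t + eta t ^+ 2 * N.
  have := step t _ (FsT t); rewrite probability_setT mule1.
  by rewrite -(fineK (EY_fin t)) -(fineK (EY_fin t.+1)) -EFinM -!EFinD lee_fin.
have [r [r0 rS r_cvg]] := summable_tail (fun t => sqr_ge0 (eta t)) sum_eta2.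
pose V t o := Y t o + N * r t.
have Nr0 t : 0 <= N * r t by exact: mulr_ge0.
have intV t s A : measurable A ->
    (\int[P]_(o in A) (Y t o + N * r s)%:E =
     \int[P]_(o in A) (Y t o)%:E + (N * r s)%:E * P A)%E.
  move=> mA; under eq_integral do rewrite EFinD.
  rewrite ge0_integralD //; try by move=> o _; rewrite lee_fin.
    by rewrite integral_cst.
  by apply/measurable_EFinP; exact: measurable_funTS.
have V0 t o : 0 <= V t o by exact: addr_ge0.
have V_cvg : {ae P, forall o, V t o @[t --> \oo] --> (0 : R)}.
  apply: (@supermartingale_cvg0 _ _ _ _ Fs) => //.
  - move=> t A B sA sB.
    pose TG := g_sigma_algebraType (history (fun t => xis t : T -> S) t).
    exact: (@measurableI _ TG).
  - by move=> t; exact: sub_historyS.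
  - by move=> t; exact: measurable_funD.
  (* [N * r t] is deterministic, so a level event of [V t] is one of [Y t] with a shifted
     threshold. *)
  - move=> t a; rewrite (_ : [set o | _] = Y t @^-1` `]-oo, a - N * r t[%classic).
      by apply: FsY; exact: measurable_itv.
    by apply/seteqP; split => o /=; rewrite in_itv /= ltrBrDr.
  - move=> t A sA; have mA := Fsm _ _ sA.
    (* Passing from [r t] to [r t.+1] releases exactly the noise [eta t ^+ 2 * N] of the step; the
       decrease term is then dropped. *)
    rewrite /V !intV // (rS t) mulrDr [N * eta t ^+ 2]mulrC EFinD.
    have eN0 : (0 <= (eta t ^+ 2 * N)%:E)%E by rewrite lee_fin mulr_ge0 ?sqr_ge0.
    have rN0 : (0 <= (N * r t.+1)%:E)%E by rewrite lee_fin.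
    rewrite (ge0_muleDl _ eN0 rN0) addeA leeD2r //.
    apply: le_trans (step t A sA); rewrite leeDl // mule_ge0 //.
      by rewrite lee_fin mulr_ge0 // ltW.
    by apply: integral_ge0 => o _; rewrite lee_fin.
  - move=> e e0.
    have [m le_e] := potential_le mu0 N0 eta0 sum_eta (fun t => fine_ge0 (EY0 t))
      r0 rS r_cvg y_step e0.
    exists m; rewrite /V intV // probability_setT mule1 -(fineK (EY_fin m)).
    by rewrite -EFinD lee_fin.
move: V_cvg; apply: filterS => o Vo.
(* [Y] lies between [0] and [V]. *)
apply: (squeeze_cvgr _ (cvg_cst 0) Vo); apply: nearW => t.
by apply/andP; split; [exact: Y0|rewrite /V lerDl].
Qed.
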